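(* Let $U:\mathbb{R}^2\to\mathbb{R}$ be a Levi potential, let $W$ be the vector field $W(x)=N(x)/K(x)$ on $\mathrm{reg}(U)$, and let $\phi_t$ be its (local) flow. Let $\gamma_0\subset\mathrm{reg}(U)$ be a (connected) smooth immersed curve contained in a level set of $U$. Then $\gamma_t:=\phi_t(\gamma_0)$ is also contained in a level set of $U$ for all $t\in\mathbb{R}$ for which it is well defined. In particular, if we fix a direct parametrization $\gamma_0:(a,b)\to\mathrm{reg}(U)$ (a smooth immersion) and the corresponding parametrizations $\gamma_t:=\phi_t\circ\gamma_0:(a,b)\to\mathrm{reg}(U)$, then $\gamma_t$ is a solution of the inverse curvature flow.
   Context: Smooth means $C^\infty$; $J:\mathbb{R}^2\to\mathbb{R}^2$, $J(x,y)=(-y,x)$. Levi potentials. For a smooth $U:\mathbb{R}^2\to\mathbb{R}$, a level orbit is a solution $q:I\to\mathbb{R}^2$ of $\ddot q=-\nabla U(q)$, defined on a maximal time interval $I\subset\mathbb{R}$, such that $s\mapsto U(q(s))$ is constant on $I$. $U$ is a Levi potential if every point of $\mathbb{R}^2$ lies on a level orbit of $U$. Set $\mathrm{crit}(U)=\{\nabla U=0\}$ and $\mathrm{reg}(U)=\mathbb{R}^2\setminus\mathrm{crit}(U)$. For $x\in\mathrm{reg}(U)$ let $\ell_x=U^{-1}(U(x))\cap\mathrm{reg}(U)$ and $N(x)=\nabla U(x)/\|\nabla U(x)\|$; orient $\ell_x$ so that $JN(x)$ is a positive tangent vector. A parametrized smooth immersed curve contained in some $\ell_x$ is direct if its orientation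 agrees with that of $\ell_x$. $K:\mathrm{reg}(U)\to\mathbb{R}$ is the smooth function such that $K(x)$ is the signed geodesic curvature at $x$ of the oriented curve $\ell_x$ with respect to $N(x)$; i.e. for a direct level orbit $q$ with $q(0)=x$, $K(x)=-\langle N(q(0)),\ddot q(0)\rangle/\|\dot q(0)\|^2$. For a Levi potential, $K$ is everywhere positive. Inverse curvature flow. For a smooth immersed curve $\gamma$ with parameter $s$, set $T_\gamma=\dot\gamma/\|\dot\gamma\|$, $N_\gamma=-JT_\gamma$, $K_\gamma=-\langle\dot T_\gamma,N_\gamma\rangle/\|\dot\gamma\|$. A smooth family of smooth immersed curves $\gamma_t$ with nowhere-vanishing $K_{\gamma_t}$ is a solution of the inverse curvature flow if $\partial_t\gamma_t=N_{\gamma_t}/K_{\gamma_t}$. *)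

(* Defs.v *)
From Stdlib Require Import Reals.
From Coquelicot Require Import Coquelicot.
Open Scope R_scope.

Definition dot (p q : R * R) : R := fst p * fst q + snd p * snd q.
Definition enorm (p : R * R) : R := sqrt (dot p p).
Definition J (p : R * R) : R * R := (- snd p, fst p).

Definition in_itv (a b : Rbar) (s : R) : Prop := Rbar_lt a s /\ Rbar_lt s b.

(* [Ck n O f] : f is of class C^n on the open set O.  For finite-dimensional V,
   asking that p |-> L p v be C^m for each fixed v amounts to asking that the
   Frechet derivative L be a C^m map into Hom(V, W). *)
Fixpoint Ck {V W : NormedModule R_AbsRing} (n : nat) (O : V -> Prop)
    (f : V -> W) : Prop :=
  match n with
  | 0%nat => forall p, O p -> continuous f p
  | S m => exists L : V -> V -> W,
      (forall p, O p -> filterdiff f (locally p) (L p)) /\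
      (forall v, Ck m O (fun p => L p v))
  end.

Definition smooth_on {V W : NormedModule R_AbsRing} (O : V -> Prop)
    (f : V -> W) : Prop := forall n, Ck n O f.

Definition grad (U : R * R -> R) (p : R * R) : R * R :=
  (Derive (fun x => U (x, snd p)) (fst p),
   Derive (fun y => U (fst p, y)) (snd p)).

Definition reg (U : R * R -> R) (p : R * R) : Prop := grad U p <> (0, 0).

(* N(p); only meaningful on [reg U]. *)
Definition unit_grad (U : R * R -> R) (p : R * R) : R * R :=
  scal (/ enorm (grad U p)) (grad U p).

Definition newton_solution (U : R * R -> R) (a b : Rbar) (q : R -> R * R)
    : Prop :=
  exists v : R -> R * R, forall s, in_itv a b s ->
    is_derive q s (v s) /\ is_derive v s (opp (grad U (q s))).

(* Maximal solutions of a second order ODE with smooth right-hand side live on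
   open intervals, here with endpoints in [Rbar]. *)
Definition maximal_newton_solution (U : R * R -> R) (a b : Rbar)
    (q : R -> R * R) : Prop :=
  newton_solution U a b q /\
  forall (a' b' : Rbar) (q' : R -> R * R),
    Rbar_le a' a -> Rbar_le b b' ->
    newton_solution U a' b' q' ->
    (forall s, in_itv a b s -> q' s = q s) ->
    a' = a /\ b' = b.

Definition level_orbit (U : R * R -> R) (a b : Rbar) (q : R -> R * R) : Prop :=
  Rbar_lt a b /\ maximal_newton_solution U a b q /\
  exists c, forall s, in_itv a b s -> U (q s) = c.

Definition levi_potential (U : R * R -> R) : Prop :=
  smooth_on (fun _ => True) U /\
  forall x, exists (a b : Rbar) (q : R -> R * R) (s : R),
    level_orbit U a b q /\ in_itv a b s /\ q s = x.

Definition velocity (g : R -> R * R) (s : R) : R * R :=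
  (Derive (fun u => fst (g u)) s, Derive (fun u => snd (g u)) s).

Definition immersed_curve (a b : Rbar) (g : R -> R * R) : Prop :=
  smooth_on (in_itv a b) g /\
  forall s, in_itv a b s -> velocity g s <> (0, 0).

Definition unit_tangent (g : R -> R * R) (s : R) : R * R :=
  scal (/ enorm (velocity g s)) (velocity g s).
Definition unit_normal (g : R -> R * R) (s : R) : R * R :=
  opp (J (unit_tangent g s)).
Definition curvature (g : R -> R * R) (s : R) : R :=
  - dot (velocity (unit_tangent g) s) (unit_normal g s) / enorm (velocity g s).

Definition in_level_set (U : R * R -> R) (a b : Rbar) (g : R -> R * R) : Prop :=
  exists c, forall s, in_itv a b s -> U (g s) = c.

(* For curves lying in the regular part of a level set: the velocity is a
   positive multiple of J N. *)
Definition direct (U : R * R -> R) (a b : Rbar) (g : R -> R * R) : Prop :=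
  forall s, in_itv a b s -> 0 < dot (velocity g s) (J (unit_grad U (g s))).

(* K x is the curvature at x of the oriented level curve through x, computed in
   any direct parametrization.  For such a parametrization [unit_normal] is
   [unit_grad U], so this is the curvature with respect to N(x). *)
Definition level_curvature (U K : R * R -> R) : Prop :=
  forall (a b : Rbar) (g : R -> R * R),
    immersed_curve a b g ->
    (forall s, in_itv a b s -> reg U (g s)) ->
    in_level_set U a b g ->
    direct U a b g ->
    forall s, in_itv a b s -> K (g s) = curvature g s.

Definition integral_curve (O : R * R -> Prop) (W : R * R -> R * R) (a b : Rbar)
    (c : R -> R * R) : Prop :=
  forall t, in_itv a b t -> O (c t) /\ is_derive c t (W (c t)).

(* [phi], defined on the open set [D] of R x O, is the (smooth, maximal) flow
   of the smooth vector field W on the open set O; [D t x] says that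
   [phi t x] is defined. *)
Record is_flow (O : R * R -> Prop) (W : R * R -> R * R)
    (D : R -> R * R -> Prop) (phi : R -> R * R -> R * R) : Prop := {
  flow_dom : forall t x, D t x -> O x;
  flow_open : open (fun z : R * (R * R) => D (fst z) (snd z));
  flow_smooth : smooth_on (fun z : R * (R * R) => D (fst z) (snd z))
                          (fun z : R * (R * R) => phi (fst z) (snd z));
  flow_zero : forall x, O x -> D 0 x /\ phi 0 x = x;
  flow_itv : forall x t1 t t2, D t1 x -> D t2 x -> t1 <= t <= t2 -> D t x;
  flow_ode : forall t x, D t x ->
    O (phi t x) /\ is_derive (fun u => phi u x) t (W (phi t x));
  flow_max : forall x (a b : Rbar) (c : R -> R * R),
    O x -> in_itv a b 0 -> integral_curve O W a b c -> c 0 = x ->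
    forall t, in_itv a b t -> D t x
}.

(* The curve at time t is [g t], defined on the slice {s | Om t s}, so that the
   domain of the curve is allowed to depend on t. *)
Definition icf_solution (Om : R -> R -> Prop) (g : R -> R -> R * R) : Prop :=
  open (fun z : R * R => Om (fst z) (snd z)) /\
  smooth_on (fun z : R * R => Om (fst z) (snd z))
            (fun z : R * R => g (fst z) (snd z)) /\
  forall t s, Om t s ->
    velocity (g t) s <> (0, 0) /\
    curvature (g t) s <> 0 /\
    is_derive (fun u => g u s) t (scal (/ curvature (g t) s) (unit_normal (g t) s)).

(* Main.v *)
Require Import Defs.
From Stdlib Require Import Reals Lra Classical.
From Coquelicot Require Import Coquelicot.
Open Scope R_scope.

(** Let W = N / K and let F = <grad U, W> be the rate at which U grows along the
flow.  The theorem rests on one fact: F is constant along the regular level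
curves, that is, dF = lambda dU on [reg U] for some continuous lambda.

This comes from energy conservation.  A level orbit q keeps U(q), hence also
|q'|^2, constant ([newton_speed]); q' cannot vanish at a regular point, since q
would then be at rest and grad U zero.  So q is a regular parametrization of
the level curve, with acceleration - grad U, and its curvature is
K(q) = |grad U(q)| / |q'|^2 ([orbit_curvature]).  This shows K > 0 and
F(q) = |grad U(q)| / K(q) = |q'|^2 ([orbit_rate]), a constant; hence dF kills
q', which spans the kernel of dU ([rate_differential_parallel]).  The field W
is smooth because it is the time derivative at 0 of its smooth flow
([flow_field_Ck]).

Now put gamma(t, s) = phi_t(gamma_0(s)) and V = d gamma / ds.  Exchanging mixed
derivatives gives
    d/dt (dU(V)) = d/ds (dU(W)) = dF(V) = lambda dU(V),
a linear equation in t with initial value 0, so dU(V) = 0: the curve gamma_t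
stays in a level set ([tangency_preserved], [flow_tangent_to_levels]).  In the
same way dV/dt = DW(V), so V does not vanish if it does not at time 0
([immersion_preserved]).  Thus <V, J grad U> is continuous in t and never zero;
it keeps its sign, and gamma_t is a direct parametrization of a level curve.
Its normal is then N and its curvature is K, and the equation of the flow of W
reads as the inverse curvature flow.

Smoothness in the sense of [Ck] has to be carried through compositions several
times: to get that q is smooth by bootstrapping Newton's equation, that gamma is
smooth in both variables, and that each gamma_t is. *)

(** * Derivatives of paired and composed maps *)

Lemma filterdiff_pair {V W1 W2 : NormedModule R_AbsRing} (f : V -> W1) (g : V -> W2)
  (p : V) (lf : V -> W1) (lg : V -> W2) :
  filterdiff f (locally p) lf -> filterdiff g (locally p) lg ->
  filterdiff (fun x => (f x, g x)) (locally p) (fun v => (lf v, lg v)).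
Proof.
  intros Hf Hg.
  apply (filterdiff_comp'_2 f g (fun u v => (u, v)) p lf lg (fun u v => (u, v)) Hf Hg).
  apply filterdiff_linear, is_linear_prod; [apply is_linear_fst | apply is_linear_snd].
Qed.

Lemma filterdiff_is_derive {V W : NormedModule R_AbsRing} (f : V -> W) (c : R -> V)
  (t : R) (l : V -> W) (v : V) :
  filterdiff f (locally (c t)) l -> is_derive c t v ->
  is_derive (fun u => f (c u)) t (l v).
Proof.
  intros Hf Hc.
  apply (filterdiff_ext_lin _ _ _
           (filterdiff_comp' c f t _ l Hc Hf)).
  intros y; apply (linear_scal l (proj1 Hf)).
Qed.

Lemma is_derive_pair {V W : NormedModule R_AbsRing} (f : R -> V) (g : R -> W) t v w :
  is_derive f t v -> is_derive g t w -> is_derive (fun u => (f u, g u)) t (v, w).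
Proof.
  intros Hf Hg.
  apply (filterdiff_ext_lin _ _ _ (filterdiff_pair _ _ _ _ _ Hf Hg)).
  reflexivity.
Qed.

Lemma is_derive_fst {V W : NormedModule R_AbsRing} (f : R -> V * W) t v :
  is_derive f t v -> is_derive (fun u => fst (f u)) t (fst v).
Proof.
  apply (filterdiff_is_derive fst f t fst v), filterdiff_linear, is_linear_fst.
Qed.

Lemma is_derive_snd {V W : NormedModule R_AbsRing} (f : R -> V * W) t v :
  is_derive f t v -> is_derive (fun u => snd (f u)) t (snd v).
Proof.
  apply (filterdiff_is_derive snd f t snd v), filterdiff_linear, is_linear_snd.
Qed.

(** * Calculus of maps of class C^n *)

Section CkCalculus.
Context {V : NormedModule R_AbsRing}.

Lemma Ck_weaken {W : NormedModule R_AbsRing} n O (f : V -> W) : Ck (S n) O f -> Ck n O f.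
Proof.
  revert f; induction n as [|n IH]; intros f [L [HL HC]].
  - intros p Hp. apply filterdiff_continuous. exists (L p). now apply HL.
  - exists L. split; [exact HL|]. intros v. apply IH, HC.
Qed.

Lemma Ck_subset {W : NormedModule R_AbsRing} n (O O' : V -> Prop) (f : V -> W) :
  (forall p, O' p -> O p) -> Ck n O f -> Ck n O' f.
Proof.
  intros HO; revert f; induction n as [|n IH]; intros f.
  - intros H p Hp. now apply H, HO.
  - intros [L [HL HC]]. exists L. split; auto.
Qed.

Lemma Ck_ext {W : NormedModule R_AbsRing} n (O : V -> Prop) (f g : V -> W) :
  open O -> (forall p, O p -> f p = g p) -> Ck n O f -> Ck n O g.
Proof.
  intros HO Hfg. destruct n as [|n].
  - intros H p Hp. apply (continuous_ext_loc _ f); [|now apply H].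
    apply (filter_imp O); [exact Hfg | now apply HO].
  - intros [L [HL HC]]. exists L. split; [|exact HC].
    intros p Hp. apply (filterdiff_ext_loc f g).
    + apply (filter_imp O); [exact Hfg | now apply HO].
    + intros x Hx. apply is_filter_lim_locally_unique in Hx. subst x. now apply Hfg.
    + now apply HL.
Qed.

Lemma Ck_const {W : NormedModule R_AbsRing} n (O : V -> Prop) (w : W) :
  Ck n O (fun _ : V => w).
Proof.
  revert w; induction n as [|n IH]; intros w.
  - intros p _. apply continuous_const.
  - exists (fun _ _ => zero). split; [|intros _; apply IH].
    intros p _. apply filterdiff_const.
Qed.

Lemma Ck_linear {W X : NormedModule R_AbsRing} n (O : V -> Prop) (f : V -> W) (l : W -> X) :
  is_linear l -> Ck n O f -> Ck n O (fun p => l (f p)).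
Proof.
  intros Hl. revert f; induction n as [|n IH]; intros f.
  - intros H p Hp. apply continuous_comp; [now apply H|]. now apply linear_cont.
  - intros [L [HL HC]]. exists (fun p v => l (L p v)). split.
    + intros p Hp. apply (filterdiff_comp' f l); [now apply HL|].
      now apply filterdiff_linear.
    + intros v. now apply IH.
Qed.

Lemma Ck_id n (O : V -> Prop) : Ck n O (fun p => p).
Proof.
  destruct n as [|n].
  - intros p _. apply continuous_id.
  - exists (fun _ v => v). split; [|intros v; apply Ck_const].
    intros p _. apply filterdiff_linear, is_linear_id.
Qed.

Lemma Ck_pair {W X : NormedModule R_AbsRing} n (O : V -> Prop) (f : V -> W) (g : V -> X) :
  Ck n O f -> Ck n O g -> Ck n O (fun p => (f p, g p)).
Proof.
  revert f g; induction n as [|n IH]; intros f g.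
  - intros Hf Hg p Hp.
    apply (continuous_comp_2 f g (fun u v => (u, v))); [now apply Hf|now apply Hg|].
    apply (continuous_ext (fun x => x)); [now intros []|]. apply continuous_id.
  - intros [L [HL HC]] [M [HM HD]]. exists (fun p v => (L p v, M p v)). split.
    + intros p Hp. apply filterdiff_pair; auto.
    + intros v. apply IH; auto.
Qed.

Lemma Ck_plus {W : NormedModule R_AbsRing} n (O : V -> Prop) (f g : V -> W) :
  Ck n O f -> Ck n O g -> Ck n O (fun p => plus (f p) (g p)).
Proof.
  intros Hf Hg.
  exact (Ck_linear n O _ _ is_linear_plus (Ck_pair n O f g Hf Hg)).
Qed.

Lemma Ck_scal {W : NormedModule R_AbsRing} n (O : V -> Prop) (k : V -> R) (f : V -> W) :
  Ck n O k -> Ck n O f -> Ck n O (fun p => scal (k p) (f p)).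
Proof.
  revert k f; induction n as [|n IH]; intros k f Hk Hf.
  - intros p Hp. apply (continuous_scal k f); [now apply Hk | now apply Hf].
  - pose proof (Ck_weaken _ _ _ Hk) as Hk'. pose proof (Ck_weaken _ _ _ Hf) as Hf'.
    destruct Hk as [L [HL HC]], Hf as [M [HM HD]].
    exists (fun p v => plus (scal (L p v) (f p)) (scal (k p) (M p v))). split.
    + intros p Hp. apply (filterdiff_scal_fct p k f); auto. exact Rmult_comm.
    + intros v. apply Ck_plus; apply IH; auto.
Qed.
End CkCalculus.

(** The composition rule differentiates h o f to M(f p)(L p v), where the linear
map M(f p) is known to be C^n in p only at fixed vectors.  Evaluating it at a
C^n vector needs a finite basis of W.  This property isolates what is needed
from W, and passes from factors to products. *)
Definition Ck_evaluable (W : NormedModule R_AbsRing) : Prop :=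
  forall (V X : NormedModule R_AbsRing) n (O : V -> Prop) (A : V -> W -> X) (f : V -> W),
    open O -> (forall p, O p -> is_linear (A p)) ->
    (forall w, Ck n O (fun p => A p w)) -> Ck n O f -> Ck n O (fun p => A p (f p)).

Lemma Ck_evaluable_R : Ck_evaluable R_NormedModule.
Proof.
  intros V X n O A f HO HA HC Hf.
  apply (Ck_ext n O (fun p => scal (f p) (A p 1))); [exact HO| |].
  - intros p Hp. rewrite <- (linear_scal _ (HA p Hp)). f_equal. apply Rmult_1_r.
  - now apply Ck_scal.
Qed.

(** By linearity A p (x, y) = A p (x, 0) + A p (0, y). *)
Lemma Ck_evaluable_prod (W1 W2 : NormedModule R_AbsRing) :
  Ck_evaluable W1 -> Ck_evaluable W2 -> Ck_evaluable (prod_NormedModule _ W1 W2).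
Proof.
  intros H1 H2 V X n O A f HO HA HC Hf.
  apply (Ck_ext n O (fun p => plus (A p (fst (f p), zero)) (A p (zero, snd (f p)))));
    [exact HO| |].
  - intros p Hp. rewrite <- (linear_plus _ (HA p Hp)). f_equal.
    destruct (f p) as [x y]. apply injective_projections; simpl;
      [apply plus_zero_r|apply plus_zero_l].
  - apply Ck_plus.
    + apply (H1 V X n O (fun p w => A p (w, zero)) (fun p => fst (f p))); auto.
      * intros p Hp. apply (is_linear_comp (fun w => (w, zero)) (A p)); [|auto].
        apply is_linear_prod; [apply is_linear_id|apply is_linear_zero].
      * apply (Ck_linear n O f fst is_linear_fst Hf).
    + apply (H2 V X n O (fun p w => A p (zero, w)) (fun p => snd (f p))); auto.
      * intros p Hp. apply (is_linear_comp (fun w => (zero, w)) (A p)); [|auto].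
        apply is_linear_prod; [apply is_linear_zero|apply is_linear_id].
      * apply (Ck_linear n O f snd is_linear_snd Hf).
Qed.

(** Chain rule, by induction on n: the derivative p |-> M (f p) (L p v) is again a
composition, to which the induction hypothesis applies for every fixed vector
in place of L p v; [Ck_evaluable] then lets that vector vary with p. *)
Lemma Ck_comp {V W X : NormedModule R_AbsRing} (HW : Ck_evaluable W) n
  (O : V -> Prop) (O' : W -> Prop) (f : V -> W) (h : W -> X) :
  open O -> (forall p, O p -> O' (f p)) ->
  Ck n O f -> Ck n O' h -> Ck n O (fun p => h (f p)).
Proof.
  intros HO Hmap. revert h; induction n as [|n IH]; intros h Hf Hh.
  - intros p Hp. apply continuous_comp; [now apply Hf | now apply Hh, Hmap].
  - pose proof (Ck_weaken _ _ _ Hf) as Hf'.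
    destruct Hf as [L [HL HC]], Hh as [M [HM HD]].
    exists (fun p v => M (f p) (L p v)). split.
    + intros p Hp. apply (filterdiff_comp' f h); auto.
    + intros v. apply (HW V X n O (fun p => M (f p))); auto.
      * intros p Hp. apply (HM _ (Hmap p Hp)).
      * intros w. apply (IH (fun y => M y w)); auto.
Qed.

Lemma Ck_evaluable_plane : Ck_evaluable (prod_NormedModule _ R_NormedModule R_NormedModule).
Proof. apply Ck_evaluable_prod; apply Ck_evaluable_R. Qed.

(** * Curves and vectors in the plane *)

Lemma is_derive_velocity (g : R -> R * R) s v : is_derive g s v -> velocity g s = v.
Proof.
  intros H. destruct v as [v1 v2]. apply injective_projections; apply is_derive_unique.
  - exact (is_derive_fst g s _ H).
  - exact (is_derive_snd g s _ H).
Qed.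

Lemma velocity_ext_loc (f g : R -> R * R) s :
  locally s (fun u => f u = g u) -> velocity f s = velocity g s.
Proof.
  intros H. apply injective_projections; apply Derive_ext_loc;
    apply (filter_imp _ _ (fun u (Hu : f u = g u) => f_equal _ Hu) H).
Qed.

Lemma dot_pos (p : R * R) : p <> (0, 0) -> 0 < dot p p.
Proof.
  destruct p as [x y]; unfold dot; simpl; intros H.
  destruct (Req_dec x 0) as [->|Hx]; [|nra].
  destruct (Req_dec y 0) as [->|Hy]; [now elim H|nra].
Qed.

Lemma dot_nonzero (p : R * R) : 0 < dot p p -> p <> (0, 0).
Proof. intros H ->. unfold dot in H; simpl in H. lra. Qed.

Lemma enorm_sqr (p : R * R) : enorm p * enorm p = dot p p.
Proof. apply sqrt_def. unfold dot. nra. Qed.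

Lemma enorm_pos (p : R * R) : p <> (0, 0) -> 0 < enorm p.
Proof. intros H. apply sqrt_lt_R0. now apply dot_pos. Qed.

(** In the plane, v orthogonal to g and positive against J g is a positive
multiple of J g; rotating v back by J gives the direction of g. *)
Lemma normal_is_unit_grad (v g : R * R) :
  dot v g = 0 -> 0 < dot v (J g) ->
  opp (J (scal (/ enorm v) v)) = scal (/ enorm g) g.
Proof.
  intros H0 H1.
  assert (Hv : v <> (0,0)) by (intros ->; unfold dot in H1; simpl in H1; lra).
  assert (Hg : g <> (0,0)) by (intros ->; unfold dot, J in H1; simpl in H1; lra).
  pose proof (enorm_pos v Hv) as Pv. pose proof (enorm_pos g Hg) as Pg.
  pose proof (enorm_sqr v) as Sv. pose proof (enorm_sqr g) as Sg.
  set (a := enorm v) in *. set (b := enorm g) in *. clearbody a b.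
  destruct v as [v1 v2], g as [g1 g2]. unfold dot, J in *. simpl in *.
  (* Lagrange's identity: <v, Jg>^2 = |v|^2 |g|^2 - <v, g>^2. *)
  assert (Hd : v2 * g1 - v1 * g2 = a * b).
  { assert ((v2 * g1 - v1 * g2)² = (a * b)²).
    { unfold Rsqr. transitivity ((a * a) * (b * b)); [rewrite Sv, Sg|ring].
      assert (v1 * g1 = - (v2 * g2)) by lra.
      replace ((v2 * g1 - v1 * g2) * (v2 * g1 - v1 * g2))
        with ((v1 * v1 + v2 * v2) * (g1 * g1 + g2 * g2) - (v1 * g1 + v2 * g2) * (v1 * g1 + v2 * g2)) by ring.
      rewrite H0. ring. }
    apply Rsqr_inj; [lra|nra|assumption]. }
  assert (E1 : v2 * b = g1 * a).
  { apply Rmult_eq_reg_l with b; [|lra]. apply Rmult_eq_reg_l with a; [|lra].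
    transitivity (a * v2 * (b * b)); [ring|]. rewrite Sg.
    transitivity (g1 * (a * b) * a); [rewrite <- Hd|ring].
    transitivity (a * (v2 * g1 * g1 + (v2 * g2) * g2)); [ring|].
    replace (v2 * g2) with (- (v1 * g1)) by lra. ring. }
  assert (E2 : - v1 * b = g2 * a).
  { apply Rmult_eq_reg_l with b; [|lra]. apply Rmult_eq_reg_l with a; [|lra].
    transitivity (- a * v1 * (b * b)); [ring|]. rewrite Sg.
    transitivity (g2 * (a * b) * a); [rewrite <- Hd|ring].
    transitivity (a * (- (v1 * g1) * g1 - v1 * g2 * g2)); [ring|].
    replace (v1 * g1) with (- (v2 * g2)) by lra. ring. }
  apply injective_projections; simpl; unfold opp, scal, mult; simpl; unfold mult; simpl.
  - apply Rmult_eq_reg_l with (a * b); [|nra]. field_simplify; lra.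
  - apply Rmult_eq_reg_l with (a * b); [|nra]. field_simplify; lra.
Qed.

Lemma open_in_itv a b : open (in_itv a b).
Proof.
  intros s [Ha Hb]. apply filter_and.
  - now apply open_Rbar_gt.
  - now apply open_Rbar_lt.
Qed.

(** * Functions on an interval *)

Lemma is_derive_zero_const a b (f : R -> R) :
  (forall s, in_itv a b s -> is_derive f s 0) ->
  forall s s', in_itv a b s -> in_itv a b s' -> f s = f s'.
Proof.
  intros H s s' Hs Hs'.
  assert (Hin : forall x, Rmin s s' <= x <= Rmax s s' -> in_itv a b x).
  { intros x [H1 H2]. destruct Hs as [A1 A2], Hs' as [B1 B2]. split.
    - apply Rbar_lt_le_trans with (Rmin s s'); [|exact H1].
      unfold Rmin; destruct (Rle_dec s s'); assumption.
    - apply Rbar_le_lt_trans with (Rmax s s'); [exact H2|].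
      unfold Rmax; destruct (Rle_dec s s'); assumption. }
  destruct (MVT_gen f s s' (fun _ => 0)) as [c [Hc E]].
  - intros x Hx. apply H, Hin. lra.
  - intros x Hx. apply derivable_continuous_pt. exists 0. apply is_derive_Reals. now apply H, Hin.
  - lra.
Qed.

(** A Gronwall estimate, in either direction of time: e exp(-C t) is nonincreasing
and e exp(C t) is nondecreasing.  Running it backwards shows that a solution
of a linear equation that vanishes once vanished at the start. *)
Lemma gronwall_zero (e e' : R -> R) (C t1 t2 : R) :
  (forall t, Rmin t1 t2 <= t <= Rmax t1 t2 ->
     is_derive e t (e' t) /\ 0 <= e t /\ Rabs (e' t) <= C * e t) ->
  e t1 = 0 -> e t2 = 0.
Proof.
  intros H H1.
  set (k := if Rle_dec t1 t2 then - C else C).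
  set (h := fun t => e t * exp (k * t)).
  assert (Hh : forall t, Rmin t1 t2 <= t <= Rmax t1 t2 ->
     is_derive h t ((e' t + k * e t) * exp (k * t))).
  { intros t Ht. destruct (H t Ht) as [Hd _]. unfold h.
    evar_last.
    - apply (is_derive_mult e (fun t => exp (k * t)) t (e' t) (k * exp (k * t))); [exact Hd| |exact Rmult_comm].
      auto_derive; [easy|ring].
    - unfold plus, mult; simpl. ring. }
  destruct (MVT_gen h t1 t2 (fun t => (e' t + k * e t) * exp (k * t))) as [c [Hc E]].
  - intros x Hx. apply Hh. lra.
  - intros x Hx. apply derivable_continuous_pt. eexists. apply is_derive_Reals. now apply Hh.
  - destruct (H c Hc) as [_ [P Q]].
    assert (P2 : 0 <= e t2) by (apply H; split; [apply Rmin_r|apply Rmax_r]).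
    pose proof (exp_pos (k * c)) as X1. pose proof (exp_pos (k * t2)) as X2.
    unfold h in E. rewrite H1, Rmult_0_l in E.
    assert (e t2 * exp (k * t2) <= 0).
    { rewrite <- (Rminus_0_r (e t2 * _)), E.
      assert (S : (e' c + k * e c) * (t2 - t1) <= 0).
      { apply Rabs_le_between in Q. unfold k. destruct (Rle_dec t1 t2); nra. }
      nra. }
    nra.
Qed.

Lemma path_bounded (f : R -> R) (t1 t2 : R) :
  (forall t, Rmin t1 t2 <= t <= Rmax t1 t2 -> continuous f t) ->
  exists M, 0 <= M /\ forall t, Rmin t1 t2 <= t <= Rmax t1 t2 -> Rabs (f t) <= M.
Proof.
  intros H. destruct (bounded_continuity f (Rmin t1 t2) (Rmax t1 t2) H) as [M HM].
  exists (Rabs M). split; [apply Rabs_pos|]. intros t Ht.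
  apply Rle_trans with M; [left; now apply HM|apply Rle_abs].
Qed.

(** A continuous function without zeros keeps its sign; t1 and t2 may come in
either order since the flow is followed in both directions of time. *)
Lemma path_pos (f : R -> R) (t1 t2 : R) :
  (forall t, Rmin t1 t2 <= t <= Rmax t1 t2 -> continuous f t /\ f t <> 0) ->
  0 < f t1 -> 0 < f t2.
Proof.
  intros H H1.
  destruct (Rlt_or_le 0 (f t2)) as [|H2]; [assumption|exfalso].
  assert (H2' : f t2 <> 0) by (apply H; split; [apply Rmin_r|apply Rmax_r]).
  destruct (Rtotal_order t1 t2) as [L|[->|L]]; [| lra |].
  - destruct (Ranalysis5.IVT_interv (fun t => - f t) t1 t2) as [z [Hz E]]; try lra.
    + intros t Ht. apply continuity_pt_opp, continuity_pt_filterlim, H.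
      rewrite Rmin_left, Rmax_right; lra.
    + apply (H z); [rewrite Rmin_left, Rmax_right; lra|lra].
  - destruct (Ranalysis5.IVT_interv f t2 t1) as [z [Hz E]]; try lra.
    + intros t Ht. apply continuity_pt_filterlim, H.
      rewrite Rmin_right, Rmax_left; lra.
    + apply (H z); [rewrite Rmin_right, Rmax_left; lra|lra].
Qed.

(** * Partial derivatives *)

Lemma is_derive_partial1 {W : NormedModule R_AbsRing} (f : R * R -> W) L x y :
  filterdiff f (locally (x, y)) L -> is_derive (fun u => f (u, y)) x (L (1, 0)).
Proof.
  intros H. apply (filterdiff_is_derive f (fun u => (u, y)) x L (1, 0) H).
  apply is_derive_pair; [apply (is_derive_id x)|apply (is_derive_const y x)].
Qed.

Lemma is_derive_partial2 {W : NormedModule R_AbsRing} (f : R * R -> W) L x y :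
  filterdiff f (locally (x, y)) L -> is_derive (fun u => f (x, u)) y (L (0, 1)).
Proof.
  intros H. apply (filterdiff_is_derive f (fun u => (x, u)) y L (0, 1) H).
  apply is_derive_pair; [apply (is_derive_const x y)|apply (is_derive_id y)].
Qed.

Lemma linear_plane (l : R * R -> R) (v : R * R) :
  is_linear l -> l v = l (1, 0) * fst v + l (0, 1) * snd v.
Proof.
  intros Hl. destruct v as [x y]; simpl.
  replace (x, y) with (plus (scal x (1, 0)) (scal y (0, 1))).
  - rewrite (linear_plus l Hl), !(linear_scal l Hl).
    unfold plus, scal, mult; simpl. unfold mult; simpl. ring.
  - apply injective_projections; simpl; unfold plus, scal; simpl; unfold mult; simpl; ring.
Qed.

(** Schwarz's theorem in the form used for moving curves: the derivative in s of
f_t is usually known from the equation of motion, and the lemma turns it into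
the derivative in t of f_s. *)
Lemma Ck2_mixed (O : R * R -> Prop) (f : R * R -> R) :
  open O -> Ck 2 O f -> forall t s l, O (t, s) ->
  is_derive (fun s' => Derive (fun t' => f (t', s')) t) s l ->
  is_derive (fun t' => Derive (fun s' => f (t', s')) s) t l.
Proof.
  intros HO [L [HL HC]] t s l Hts Hl.
  destruct (HC (1, 0)) as [M [HM CM]]. destruct (HC (0, 1)) as [N [HN CN]].
  assert (Dt : forall x y, O (x, y) -> is_derive (fun u => f (u, y)) x (L (x, y) (1, 0))).
  { intros x y H. now apply is_derive_partial1, HL. }
  assert (Ds : forall x y, O (x, y) -> is_derive (fun u => f (x, u)) y (L (x, y) (0, 1))).
  { intros x y H. now apply is_derive_partial2, HL. }
  assert (Hx : forall x y, O (x, y) -> locally x (fun x' => O (x', y))).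
  { intros x y H. apply (locally_2d_1d_const_y (fun a b => O (a, b))).
    apply locally_2d_locally. apply (filter_imp O); [now intros []|now apply HO]. }
  assert (Hy : forall x y, O (x, y) -> locally y (fun y' => O (x, y'))).
  { intros x y H. apply (locally_2d_1d_const_x (fun a b => O (a, b))).
    apply locally_2d_locally. apply (filter_imp O); [now intros []|now apply HO]. }
  assert (Dst : forall x y, O (x, y) ->
    is_derive (fun s' => Derive (fun t' => f (t', s')) x) y (M (x, y) (0, 1))).
  { intros x y H. apply (is_derive_ext_loc (fun s' => L (x, s') (1, 0))).
    - apply (filter_imp (fun s' => O (x, s'))); [|now apply Hy].
      intros s' H'. symmetry. apply is_derive_unique. now apply Dt.
    - apply (is_derive_partial2 (fun p => L p (1, 0))). now apply HM. }
  assert (Dts : forall x y, O (x, y) ->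
    is_derive (fun t' => Derive (fun s' => f (t', s')) y) x (N (x, y) (1, 0))).
  { intros x y H. apply (is_derive_ext_loc (fun t' => L (t', y) (0, 1))).
    - apply (filter_imp (fun s' => O (s', y))); [|now apply Hx].
      intros s' H'. symmetry. apply is_derive_unique. now apply Ds.
    - apply (is_derive_partial1 (fun p => L p (0, 1))). now apply HN. }
  assert (HOl : locally_2d (fun u v => O (u, v)) t s).
  { apply locally_2d_locally. apply (filter_imp O); [now intros []|now apply HO]. }
  assert (E : N (t, s) (1, 0) = M (t, s) (0, 1)).
  { rewrite <- (is_derive_unique _ _ _ (Dst t s Hts)), <- (is_derive_unique _ _ _ (Dts t s Hts)).
    apply (Schwarz (fun a b => f (a, b))).
    - apply (locally_2d_impl (fun u v => O (u, v))); [|exact HOl].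
      apply locally_2d_forall. intros u v H. repeat split; eexists.
      + now apply Dt.
      + now apply Ds.
      + now apply Dts.
      + now apply Dst.
    - apply (continuity_2d_pt_ext_loc (fun u v => N (u, v) (1, 0))).
      + apply (locally_2d_impl (fun u v => O (u, v))); [|exact HOl].
        apply locally_2d_forall. intros u v H. symmetry. apply is_derive_unique. now apply Dts.
      + apply continuity_2d_pt_filterlim.
        apply (continuous_ext (fun z => N z (1, 0))
                 (fun z : R * R => N (fst z, snd z) (1, 0)) (t, s)); [now intros []|].
        exact (CN (1, 0) (t, s) Hts).
    - apply (continuity_2d_pt_ext_loc (fun u v => M (u, v) (0, 1))).
      + apply (locally_2d_impl (fun u v => O (u, v))); [|exact HOl].
        apply locally_2d_forall. intros u v H. symmetry. apply is_derive_unique. now apply Dst.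
      + apply continuity_2d_pt_filterlim.
        apply (continuous_ext (fun z => M z (0, 1))
                 (fun z : R * R => M (fst z, snd z) (0, 1)) (t, s)); [now intros []|].
        exact (CM (0, 1) (t, s) Hts). }
  replace l with (N (t, s) (1, 0)); [now apply Dts|].
  rewrite E. rewrite <- (is_derive_unique _ _ _ Hl). symmetry. now apply is_derive_unique, Dst.
Qed.

(** * Inner products of moving vectors *)

Lemma Ck_dot {V : NormedModule R_AbsRing} n (O : V -> Prop) (f g : V -> R * R) :
  Ck n O f -> Ck n O g -> Ck n O (fun p => dot (f p) (g p)).
Proof.
  intros Hf Hg. unfold dot.
  apply (Ck_plus n O (fun p => fst (f p) * fst (g p)) (fun p => snd (f p) * snd (g p))).
  - apply (Ck_scal n O (fun p => fst (f p)) (fun p => fst (g p))).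
    + exact (Ck_linear n O f fst is_linear_fst Hf).
    + exact (Ck_linear n O g fst is_linear_fst Hg).
  - apply (Ck_scal n O (fun p => snd (f p)) (fun p => snd (g p))).
    + exact (Ck_linear n O f snd is_linear_snd Hf).
    + exact (Ck_linear n O g snd is_linear_snd Hg).
Qed.

Lemma is_derive_dot (f g : R -> R * R) t df dg :
  is_derive f t df -> is_derive g t dg ->
  is_derive (fun u => dot (f u) (g u)) t (dot df (g t) + dot (f t) dg).
Proof.
  intros Hf Hg. unfold dot.
  pose proof (is_derive_mult _ _ t _ _ (is_derive_fst _ _ _ Hf) (is_derive_fst _ _ _ Hg) Rmult_comm) as H1.
  pose proof (is_derive_mult _ _ t _ _ (is_derive_snd _ _ _ Hf) (is_derive_snd _ _ _ Hg) Rmult_comm) as H2.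
  evar_last; [exact (is_derive_plus _ _ _ _ _ H1 H2)|].
  unfold plus, mult; simpl. ring.
Qed.

Lemma is_derive_const_scal {W : NormedModule R_AbsRing} (k : R) (f : R -> W) t l :
  is_derive f t l -> is_derive (fun u => scal k (f u)) t (scal k l).
Proof.
  apply (filterdiff_is_derive (fun w => scal k w) f t (fun w => scal k w) l).
  apply filterdiff_linear. exact (@is_linear_scal_r R_AbsRing W k Rmult_comm).
Qed.

Lemma is_derive_continuous {W : NormedModule R_AbsRing} (f : R -> W) t l :
  is_derive f t l -> continuous f t.
Proof. intros H. apply (filterdiff_continuous f). now exists (fun y => scal y l). Qed.

Lemma continuous_dot {T : UniformSpace} (f g : T -> R * R) t :
  continuous f t -> continuous g t -> continuous (fun u => dot (f u) (g u)) t.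
Proof.
  intros Hf Hg. unfold dot.
  apply (continuous_plus (fun u => fst (f u) * fst (g u)) (fun u => snd (f u) * snd (g u))).
  - apply (continuous_mult (fun u => fst (f u)) (fun u => fst (g u))).
    + apply (continuous_comp f fst); [assumption|]. apply (linear_cont fst (f t)), is_linear_fst.
    + apply (continuous_comp g fst); [assumption|]. apply (linear_cont fst (g t)), is_linear_fst.
  - apply (continuous_mult (fun u => snd (f u)) (fun u => snd (g u))).
    + apply (continuous_comp f snd); [assumption|]. apply (linear_cont snd (f t)), is_linear_snd.
    + apply (continuous_comp g snd); [assumption|]. apply (linear_cont snd (g t)), is_linear_snd.
Qed.

Lemma dot_comm (v w : R * R) : dot v w = dot w v.
Proof. unfold dot. ring. Qed.

Lemma dot_scal_l (k : R) (v w : R * R) : dot (scal k v) w = k * dot v w.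
Proof. destruct v, w. unfold dot, scal; simpl. unfold scal; simpl. unfold mult; simpl. ring. Qed.

Lemma dot_scal_r (k : R) (v w : R * R) : dot v (scal k w) = k * dot v w.
Proof. destruct v, w. unfold dot, scal; simpl. unfold scal; simpl. unfold mult; simpl. ring. Qed.

Lemma J_scal (k : R) (v : R * R) : J (scal k v) = scal k (J v).
Proof.
  destruct v. unfold J, scal; simpl. unfold prod_scal, scal; simpl. unfold mult; simpl.
  f_equal. ring.
Qed.

Lemma continuous_dot_J {T : UniformSpace} (f g : T -> R * R) t :
  continuous f t -> continuous g t -> continuous (fun u => dot (f u) (J (g u))) t.
Proof.
  intros Hf Hg. apply (continuous_dot f (fun u => J (g u))); [exact Hf|].
  apply (continuous_comp g J); [exact Hg|].
  apply (linear_cont J). apply (is_linear_prod (fun p => - snd p) fst); [|apply is_linear_fst].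
  apply (is_linear_comp snd Ropp); [apply is_linear_snd|].
  exact (@is_linear_opp R_AbsRing R_NormedModule).
Qed.

(** <v, g>^2 + <v, J g>^2 = |v|^2 |g|^2. *)
Lemma dot_J_neq0 (v g : R * R) :
  v <> (0, 0) -> g <> (0, 0) -> dot v g = 0 -> dot v (J g) <> 0.
Proof.
  intros Hv Hg H0 H1.
  pose proof (dot_pos v Hv) as Pv. pose proof (dot_pos g Hg) as Pg.
  assert (E : dot v v * dot g g = dot v g * dot v g + dot v (J g) * dot v (J g))
    by (unfold dot, J; simpl; ring).
  rewrite H0, H1 in E. nra.
Qed.

(** * The gradient of a smooth function *)

Lemma grad_gradient (U : R * R -> R) :
  smooth_on (fun _ => True) U ->
  forall p, filterdiff U (locally p) (fun v => dot (grad U p) v).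
Proof.
  intros HU p. destruct (HU 1%nat) as [L [HL _]]. specialize (HL p I).
  apply (filterdiff_ext_lin _ (L p)); [exact HL|]. intros v.
  rewrite (linear_plane (L p) v (proj1 HL)). unfold dot, grad; simpl.
  destruct p as [x y]; simpl. f_equal; f_equal; symmetry; apply is_derive_unique.
  - now apply (is_derive_partial1 U).
  - now apply (is_derive_partial2 U).
Qed.

Lemma grad_Ck (U : R * R -> R) n :
  smooth_on (fun _ => True) U -> Ck n (fun _ => True) (grad U).
Proof.
  intros HU. destruct (HU (S n)) as [L [HL HC]].
  apply (Ck_ext n _ (fun p => (L p (1, 0), L p (0, 1)))).
  - apply open_true.
  - intros [x y] _. apply injective_projections; simpl; symmetry; apply is_derive_unique.
    + now apply (is_derive_partial1 U), HL.
    + now apply (is_derive_partial2 U), HL.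
  - apply Ck_pair; apply HC.
Qed.

Lemma grad_continuous (U : R * R -> R) p :
  smooth_on (fun _ => True) U -> continuous (grad U) p.
Proof. intros HU. exact (grad_Ck U 0 HU p I). Qed.

Lemma reg_open (U : R * R -> R) : smooth_on (fun _ => True) U -> open (reg U).
Proof.
  intros HU. apply (open_ext (fun p => 0 < dot (grad U p) (grad U p))).
  - intros p. split; [apply dot_nonzero|apply dot_pos].
  - apply (open_comp (fun p => dot (grad U p) (grad U p)) (fun y => 0 < y)).
    + intros p _. apply continuous_dot; now apply grad_continuous.
    + apply open_gt.
Qed.

(** * Level orbits *)

(** Bootstrapping: if q and v are C^n then so is grad U(q), so the equations
q' = v and v' = - grad U(q) make q and v of class C^(n+1). *)
Lemma newton_smooth (U : R * R -> R) a b (q v : R -> R * R) :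
  smooth_on (fun _ => True) U ->
  (forall s, in_itv a b s -> is_derive q s (v s) /\ is_derive v s (opp (grad U (q s)))) ->
  smooth_on (in_itv a b) q.
Proof.
  intros HU H.
  enough (Hn : forall n, Ck n (in_itv a b) q /\ Ck n (in_itv a b) v) by (intros n; apply Hn).
  induction n as [|n [IHq IHv]].
  - split; intros s Hs.
    + apply (is_derive_continuous q s _ (proj1 (H s Hs))).
    + apply (is_derive_continuous v s _ (proj2 (H s Hs))).
  - split.
    + exists (fun s y => scal y (v s)). split; [apply H|].
      intros y. apply (Ck_scal n _ (fun _ => y) v); [apply Ck_const|exact IHv].
    + exists (fun s y => scal y (opp (grad U (q s)))). split; [apply H|].
      intros y. apply (Ck_scal n _ (fun _ => y) (fun s => opp (grad U (q s)))); [apply Ck_const|].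
      apply (Ck_linear n _ (fun s => grad U (q s)) opp is_linear_opp).
      apply (Ck_comp Ck_evaluable_plane n _ (fun _ => True) q (grad U)); auto.
      * apply open_in_itv.
      * now apply grad_Ck.
Qed.

(** The piece of a level orbit near a regular point, run in the direction that
agrees with the orientation of the level curve.  Condition [orbit_direct]
alone keeps q in [reg U] and v nonzero. *)
Record direct_orbit (U : R * R -> R) (a b : Rbar) (q v : R -> R * R) : Prop := {
  orbit_velocity : forall s, in_itv a b s -> is_derive q s (v s);
  orbit_newton : forall s, in_itv a b s -> is_derive v s (opp (grad U (q s)));
  orbit_level : in_level_set U a b q;
  orbit_direct : forall s, in_itv a b s -> 0 < dot (v s) (J (grad U (q s)))
}.

Lemma level_curve_tangent (U : R * R -> R) a b (q : R -> R * R) s v :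
  smooth_on (fun _ => True) U -> in_level_set U a b q -> in_itv a b s ->
  is_derive q s v -> dot (grad U (q s)) v = 0.
Proof.
  intros HU [c Hc] Hs Hq.
  pose proof (filterdiff_is_derive U q s _ _ (grad_gradient U HU (q s)) Hq) as H.
  rewrite <- (is_derive_unique _ _ _ H).
  rewrite (Derive_ext_loc _ (fun _ => c)); [apply Derive_const|].
  apply (filter_imp (in_itv a b)); [exact Hc|now apply open_in_itv].
Qed.

(** Conservation of energy: the potential part is constant on a level orbit, so
the kinetic part is too. *)
Lemma newton_speed (U : R * R -> R) a b (q v : R -> R * R) :
  smooth_on (fun _ => True) U -> in_level_set U a b q ->
  (forall s, in_itv a b s -> is_derive q s (v s) /\ is_derive v s (opp (grad U (q s)))) ->
  forall s s', in_itv a b s -> in_itv a b s' -> dot (v s) (v s) = dot (v s') (v s').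
Proof.
  intros HU HL H. apply (is_derive_zero_const a b (fun s => dot (v s) (v s))).
  intros s Hs. destruct (H s Hs) as [Hq Hv].
  evar_last; [exact (is_derive_dot v v s _ _ Hv Hv)|].
  pose proof (level_curve_tangent U a b q s (v s) HU HL Hs Hq) as T.
  unfold dot, opp in *; simpl in *; unfold opp; simpl. lra.
Qed.

(** At a regular point the velocity of the level orbit is a nonzero multiple of
J grad U: if it were zero, conservation of speed would make the orbit
stationary and grad U zero.  Reversing time, if need be, makes the multiple
positive, and by continuity it stays so on a short interval. *)
Lemma levi_direct_orbit (U : R * R -> R) x :
  levi_potential U -> reg U x ->
  exists a b q v, direct_orbit U a b q v /\ in_itv a b 0 /\ q 0 = x.
Proof.
  intros [HU HO] Hx.
  destruct (HO x) as (a & b & q & s0 & (_ & [[v Hqv] _] & HL) & Hs0 & <-).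
  pose proof (newton_speed U a b q v HU HL Hqv) as HE.
  pose proof (fun s Hs => level_curve_tangent U a b q s (v s) HU HL Hs (proj1 (Hqv s Hs))) as HT.
  assert (Hv0 : v s0 <> (0, 0)).
  { intros E. apply Hx.
    assert (Hv : forall s, in_itv a b s -> v s = (0, 0)).
    { intros s Hs. apply NNPP. intros N. apply dot_pos in N.
      rewrite (HE s s0 Hs Hs0), E in N. unfold dot in N; simpl in N. lra. }
    pose proof (is_derive_velocity _ _ _ (proj2 (Hqv s0 Hs0))) as D.
    rewrite (velocity_ext_loc v (fun _ => (0, 0))) in D.
    - unfold velocity in D; simpl in D. rewrite !Derive_const in D.
      rewrite <- (opp_opp (grad U (q s0))), <- D. apply (@opp_zero (prod_AbelianGroup R_AbelianGroup R_AbelianGroup)).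
    - apply (filter_imp (in_itv a b)); [exact Hv|now apply open_in_itv]. }
  assert (HJ : dot (v s0) (J (grad U (q s0))) <> 0).
  { apply dot_J_neq0; auto. rewrite dot_comm. exact (HT s0 Hs0). }
  (* sg is the direction of time in which the orbit is run. *)
  assert (Hsig : exists sg, sg * sg = 1 /\ 0 < sg * dot (v s0) (J (grad U (q s0)))).
  { destruct (Rlt_or_le 0 (dot (v s0) (J (grad U (q s0))))); [exists 1|exists (-1)]; lra. }
  destruct Hsig as [sg [Hsg Hpos]].
  assert (Hloc : locally s0 (fun s => in_itv a b s /\ 0 < sg * dot (v s) (J (grad U (q s))))).
  { apply filter_and; [now apply open_in_itv|].
    assert (C : continuous (fun s => sg * dot (v s) (J (grad U (q s)))) s0).
    { apply (continuous_mult (fun _ => sg)); [apply continuous_const|].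
      apply continuous_dot_J.
      - apply (is_derive_continuous v s0 _ (proj2 (Hqv s0 Hs0))).
      - apply (continuous_comp q (grad U)); [|now apply grad_continuous].
        apply (is_derive_continuous q s0 _ (proj1 (Hqv s0 Hs0))). }
    apply C. now apply open_gt. }
  destruct Hloc as [d Hd].
  assert (Hb : forall u, in_itv (- d) d u -> ball s0 d (s0 + sg * u)).
  { intros u [H1 H2]. simpl in H1, H2.
    change (Rabs (s0 + sg * u - s0) < d).
    assert (sg = 1 \/ sg = -1) as [-> | ->] by nra; apply Rabs_def1; lra. }
  assert (Haff : forall u, is_derive (fun u => s0 + sg * u) u sg).
  { intros u. auto_derive; [easy|ring]. }
  exists (- d)%R, (d : R), (fun u => q (s0 + sg * u)), (fun u => scal sg (v (s0 + sg * u))).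
  split; [split|split].
  - intros u Hu. destruct (Hd _ (Hb u Hu)) as [Hin _].
    apply (is_derive_comp q (fun u => s0 + sg * u)); [now apply Hqv|apply Haff].
  - intros u Hu. destruct (Hd _ (Hb u Hu)) as [Hin _].
    evar_last.
    + apply (is_derive_const_scal sg (fun u => v (s0 + sg * u)) u).
      apply (is_derive_comp v (fun u => s0 + sg * u)); [now apply Hqv|apply Haff].
    + rewrite scal_assoc. change (mult sg sg) with (sg * sg). rewrite Hsg. exact (scal_one (opp (grad U (q (s0 + sg * u))))).
  - destruct HL as [c Hc]. exists c. intros u Hu. apply Hc. now apply (Hd _ (Hb u Hu)).
  - intros u Hu. destruct (Hd _ (Hb u Hu)) as [_ Hp].
    eapply Rlt_le_trans; [exact Hp|]. right. symmetry. apply dot_scal_l.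
  - split; simpl; destruct d; simpl; lra.
  - f_equal. ring.
Qed.

Lemma direct_orbit_facts (U : R * R -> R) a b q v s :
  smooth_on (fun _ => True) U -> direct_orbit U a b q v -> in_itv a b s ->
  reg U (q s) /\ v s <> (0, 0) /\ dot (v s) (grad U (q s)) = 0.
Proof.
  intros HU Ho Hs. pose proof (orbit_direct _ _ _ _ _ Ho s Hs) as Hd.
  repeat split.
  - intros E. rewrite E in Hd. unfold dot, J in Hd; simpl in Hd. lra.
  - intros E. rewrite E in Hd. unfold dot, J in Hd; simpl in Hd. lra.
  - rewrite dot_comm.
    exact (level_curve_tangent U a b q s (v s) HU (orbit_level _ _ _ _ _ Ho) Hs
             (orbit_velocity _ _ _ _ _ Ho s Hs)).
Qed.

Lemma dot_J_unit_grad (U : R * R -> R) p v :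
  reg U p -> (0 < dot v (J (unit_grad U p)) <-> 0 < dot v (J (grad U p))).
Proof.
  intros Hp. pose proof (Rinv_0_lt_compat _ (enorm_pos _ Hp)) as P.
  unfold unit_grad. rewrite J_scal, dot_scal_r. nra.
Qed.

(** Along a direct orbit |v| is a constant c, so T = v / c, T' = - grad U / c and
the normal is grad U / |grad U|; hence - <T', N> / c = |grad U| / c^2. *)
Lemma orbit_curvature (U K : R * R -> R) a b q v s :
  smooth_on (fun _ => True) U -> level_curvature U K ->
  direct_orbit U a b q v -> in_itv a b s ->
  K (q s) = enorm (grad U (q s)) / dot (v s) (v s).
Proof.
  intros HU HK Ho Hs.
  assert (Hvel : forall u, in_itv a b u -> velocity q u = v u).
  { intros u Hu. apply is_derive_velocity, (orbit_velocity _ _ _ _ _ Ho u Hu). }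
  assert (HN : forall u, in_itv a b u -> is_derive q u (v u) /\ is_derive v u (opp (grad U (q u)))).
  { intros u Hu. split; [apply (orbit_velocity _ _ _ _ _ Ho u Hu)|apply (orbit_newton _ _ _ _ _ Ho u Hu)]. }
  pose proof (orbit_level _ _ _ _ _ Ho) as HL.
  rewrite (HK a b q); auto.
  - destruct (direct_orbit_facts U a b q v s HU Ho Hs) as [Hr [Hv Ht]].
    assert (HT : velocity (unit_tangent q) s = scal (/ enorm (v s)) (opp (grad U (q s)))).
    { rewrite (velocity_ext_loc _ (fun u => scal (/ enorm (v s)) (v u))).
      - apply is_derive_velocity.
        apply (is_derive_const_scal _ v s). now apply HN.
      - apply (filter_imp (in_itv a b)); [|now apply open_in_itv].
        intros u Hu. unfold unit_tangent. rewrite (Hvel u Hu).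
        unfold enorm. now rewrite (newton_speed U a b q v HU HL HN u s). }
    assert (HNu : unit_normal q s = scal (/ enorm (grad U (q s))) (grad U (q s))).
    { unfold unit_normal, unit_tangent. rewrite (Hvel s Hs).
      apply normal_is_unit_grad; [exact Ht|apply (orbit_direct _ _ _ _ _ Ho s Hs)]. }
    unfold curvature. rewrite HT, HNu, (Hvel s Hs).
    pose proof (enorm_pos _ Hv) as Pv. pose proof (enorm_pos _ Hr) as Pg.
    pose proof (enorm_sqr (v s)) as Sv. pose proof (enorm_sqr (grad U (q s))) as Sg.
    rewrite <- Sv.
    set (c := enorm (v s)) in *. set (g := enorm (grad U (q s))) in *.
    transitivity (dot (grad U (q s)) (grad U (q s)) / (c * g * c)).
    + rewrite dot_scal_l, dot_scal_r.
      replace (dot (opp (grad U (q s))) (grad U (q s))) with (- dot (grad U (q s)) (grad U (q s)))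
        by (unfold dot, opp; simpl; unfold opp; simpl; ring).
      field. lra.
    + rewrite <- Sg. field. lra.
  - split; [now apply (newton_smooth U a b q v)|].
    intros u Hu. rewrite (Hvel u Hu). now apply (direct_orbit_facts U a b q v u).
  - intros u Hu. now apply (direct_orbit_facts U a b q v u).
  - intros u Hu. rewrite (Hvel u Hu). apply dot_J_unit_grad.
    + now apply (direct_orbit_facts U a b q v u).
    + now apply (orbit_direct _ _ _ _ _ Ho u).
Qed.

Lemma curvature_pos (U K : R * R -> R) x :
  levi_potential U -> level_curvature U K -> reg U x -> 0 < K x.
Proof.
  intros HL HK Hx. destruct (levi_direct_orbit U x HL Hx) as (a & b & q & v & Ho & H0 & <-).
  rewrite (orbit_curvature U K a b q v 0 (proj1 HL) HK Ho H0).
  apply Rdiv_lt_0_compat; [now apply enorm_pos|].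
  apply dot_pos. now apply (direct_orbit_facts U a b q v 0 (proj1 HL) Ho H0).
Qed.

(** * The rate of growth of U along the flow *)

Definition icf_field (U K : R * R -> R) (x : R * R) : R * R := scal (/ K x) (unit_grad U x).

(** <grad U, W> = |grad U| / K, and K = |grad U| / |v|^2 on the orbit. *)
Lemma orbit_rate (U K : R * R -> R) a b q v s :
  smooth_on (fun _ => True) U -> level_curvature U K ->
  direct_orbit U a b q v -> in_itv a b s ->
  dot (grad U (q s)) (icf_field U K (q s)) = dot (v s) (v s).
Proof.
  intros HU HK Ho Hs.
  destruct (direct_orbit_facts U a b q v s HU Ho Hs) as [Hr [Hv Ht]].
  unfold icf_field. rewrite (orbit_curvature U K a b q v s HU HK Ho Hs).
  pose proof (dot_pos _ Hv) as Pv. pose proof (enorm_pos _ Hr) as Pg.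
  pose proof (enorm_sqr (grad U (q s))) as Sg. unfold unit_grad.
  set (c := dot (v s) (v s)) in *. set (g := enorm (grad U (q s))) in *.
  transitivity (dot (grad U (q s)) (grad U (q s)) * c / (g * g)).
  - rewrite !dot_scal_r. field. lra.
  - rewrite <- Sg. field. lra.
Qed.

(** The rate <grad U, W> equals |v|^2 along the orbit through x, which is
constant; so its differential l kills v(0).  As v(0) spans the orthogonal of
grad U(x), l is a multiple of <grad U(x), . >; evaluating both at grad U(x)
gives the factor, in a form that is visibly continuous in x. *)
Lemma rate_differential_parallel (U K : R * R -> R) x (l : R * R -> R) :
  levi_potential U -> level_curvature U K -> reg U x ->
  filterdiff (fun p => dot (grad U p) (icf_field U K p)) (locally x) l ->
  forall w, l w = (dot (grad U x) (l (1, 0), l (0, 1)) / dot (grad U x) (grad U x))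
                  * dot (grad U x) w.
Proof.
  intros HL HK Hx Hl w. pose proof (proj1 HL) as HU.
  destruct (levi_direct_orbit U x HL Hx) as (a & b & q & v & Ho & H0 & E).
  destruct (direct_orbit_facts U a b q v 0 HU Ho H0) as [Hr [Hv Ht]].
  assert (Hlv : l (v 0) = 0).
  { pose proof Hl as Hl'. rewrite <- E in Hl'.
    pose proof (filterdiff_is_derive _ q 0 l (v 0) Hl' (orbit_velocity _ _ _ _ _ Ho 0 H0)) as D.
    rewrite <- (is_derive_unique _ _ _ D).
    rewrite (Derive_ext_loc _ (fun _ => dot (v 0) (v 0))); [apply Derive_const|].
    apply (filter_imp (in_itv a b)); [|now apply open_in_itv].
    intros s Hs. rewrite (orbit_rate U K a b q v s HU HK Ho Hs).
    apply (newton_speed U a b q v HU (orbit_level _ _ _ _ _ Ho)); auto.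
    intros u Hu. split; [apply (orbit_velocity _ _ _ _ _ Ho u Hu)|apply (orbit_newton _ _ _ _ _ Ho u Hu)]. }
  rewrite (linear_plane l _ (proj1 Hl)) in Hlv. rewrite (linear_plane l w (proj1 Hl)).
  rewrite E in Ht. pose proof (dot_pos _ Hx) as Pg. apply dot_pos in Hv.
  set (f1 := l (1, 0)) in *. set (f2 := l (0, 1)) in *. clearbody f1 f2.
  destruct (grad U x) as [g1 g2], (v 0) as [v1 v2], w as [w1 w2].
  unfold dot in *; simpl in *.
  (* Two vectors orthogonal to the same nonzero v are parallel. *)
  assert (C : f1 * g2 = f2 * g1).
  { apply Rmult_eq_reg_r with (v1 * v1 + v2 * v2); [|lra].
    replace (f1 * g2 * (v1 * v1 + v2 * v2))
      with ((f1 * v1 + f2 * v2) * (v1 * g2 - v2 * g1) - (v1 * g1 + v2 * g2) * (v1 * f2 - v2 * f1)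
            + (v1 * v1 + v2 * v2) * f2 * g1) by ring.
    rewrite Hlv, Ht. ring. }
  apply Rmult_eq_reg_r with (g1 * g1 + g2 * g2); [|lra].
  transitivity ((g1 * f1 + g2 * f2) * (g1 * w1 + g2 * w2)); [|field; lra].
  replace ((f1 * w1 + f2 * w2) * (g1 * g1 + g2 * g2))
    with ((g1 * f1 + g2 * f2) * (g1 * w1 + g2 * w2) + (f1 * g2 - f2 * g1) * (w1 * g2 - w2 * g1)) by ring.
  rewrite C. ring.
Qed.

(** * Curves carried by a flow *)

(** W(x) is the derivative of t |-> phi t x at t = 0, hence a partial derivative
of the smooth map phi. *)
Lemma flow_field_Ck (O : R * R -> Prop) W D phi n :
  open O -> is_flow O W D phi -> Ck n O W.
Proof.
  intros HO Hf. destruct (flow_smooth _ _ _ _ Hf (S n)) as [L [HL HC]].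
  apply (Ck_ext n O (fun x => L (0, x) (1, (0, 0)))); [exact HO| |].
  - intros x Hx. destruct (flow_zero _ _ _ _ Hf x Hx) as [HD E].
    destruct (flow_ode _ _ _ _ Hf 0 x HD) as [_ Hode]. rewrite E in Hode.
    rewrite <- (is_derive_velocity _ _ _ Hode). symmetry. apply is_derive_velocity.
    apply (filterdiff_is_derive (fun z : R * (R * R) => phi (fst z) (snd z)) (fun u => (u, x))
             0 (L (0, x)) (1, (0, 0))); [now apply HL|].
    apply is_derive_pair; [apply (is_derive_id 0)|apply (is_derive_const x 0)].
  - apply (Ck_comp (Ck_evaluable_prod _ _ Ck_evaluable_R Ck_evaluable_plane) n O
            (fun z => D (fst z) (snd z)) (fun x => (0, x)) (fun z => L z (1, (0, 0)))).
    + exact HO.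
    + intros x Hx. now apply (flow_zero _ _ _ _ Hf x Hx).
    + apply Ck_pair; [apply Ck_const|apply Ck_id].
    + apply HC.
Qed.

Lemma linear_dot_bound (l : R * R -> R * R) (M N : R) (v : R * R) :
  is_linear l ->
  Rabs (fst (l (1, 0))) <= M -> Rabs (snd (l (1, 0))) <= M ->
  Rabs (fst (l (0, 1))) <= N -> Rabs (snd (l (0, 1))) <= N ->
  Rabs (dot (l v) v + dot v (l v)) <= 4 * (M + N) * dot v v.
Proof.
  intros Hl.
  pose proof (linear_plane (fun x => fst (l x)) v (is_linear_comp _ _ Hl is_linear_fst)) as E1.
  pose proof (linear_plane (fun x => snd (l x)) v (is_linear_comp _ _ Hl is_linear_snd)) as E2.
  cbv beta in E1, E2. unfold dot. rewrite E1, E2. clear E1 E2 Hl.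
  generalize (fst (l (1, 0))) (snd (l (1, 0))) (fst (l (0, 1))) (snd (l (0, 1))).
  intros p q r u Q1 Q2 Q3 Q4. destruct v as [x y]; simpl.
  replace (_ + _) with (2 * (p * (x * x)) + ((r + q) * (2 * (x * y)) + 2 * (u * (y * y)))) by ring.
  assert (X : Rabs (2 * (x * y)) <= x * x + y * y)
    by (apply Rabs_le; pose proof (Rle_0_sqr (x + y)); pose proof (Rle_0_sqr (x - y));
        unfold Rsqr in *; lra).
  assert (R1 : Rabs (p * (x * x)) <= M * (x * x)).
  { rewrite Rabs_mult, (Rabs_right (x * x)) by nra. nra. }
  assert (R2 : Rabs (u * (y * y)) <= N * (y * y)).
  { rewrite Rabs_mult, (Rabs_right (y * y)) by nra. nra. }
  assert (R3 : Rabs ((r + q) * (2 * (x * y))) <= (N + M) * (x * x + y * y)).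
  { rewrite Rabs_mult. apply Rmult_le_compat; auto using Rabs_pos.
    eapply Rle_trans; [apply Rabs_triang|lra]. }
  pose proof (Rabs_pos p). pose proof (Rabs_pos u).
  apply Rabs_le_between in R1, R2, R3. apply Rabs_le.
  split; nra.
Qed.

(** In this section a curve g0 is carried by the flow phi of any field W on an open
set O of the plane.  The time t may be of either sign, and the flow may leave
different points of the curve at different times, so everything is stated at
the points (t, s) where phi t (g0 s) is defined. *)
Section MovingCurve.
Context (O : R * R -> Prop) (W : R * R -> R * R)
  (D : R -> R * R -> Prop) (phi : R -> R * R -> R * R) (a b : Rbar) (g0 : R -> R * R).
Context (HO : open O) (Hphi : is_flow O W D phi)
  (Hg : smooth_on (in_itv a b) g0) (HgO : forall s, in_itv a b s -> O (g0 s)).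

Definition moving_domain (z : R * R) : Prop := in_itv a b (snd z) /\ D (fst z) (g0 (snd z)).

Lemma moving_domain_open : open moving_domain.
Proof.
  intros [t s] [Hs HD]. apply filter_and.
  - apply (continuous_snd t s). now apply open_in_itv.
  - assert (C : continuous (fun z : R * R => (fst z, g0 (snd z))) (t, s)).
    { apply (continuous_comp_2 fst (fun z : R * R => g0 (snd z)) (fun u v => (u, v))).
      - apply continuous_fst.
      - apply (continuous_comp snd g0); [apply continuous_snd|]. exact (Hg 0%nat s Hs).
      - apply (continuous_ext (fun x => x)); [now intros []|]. apply continuous_id. }
    apply (C (fun z => D (fst z) (snd z))). apply (flow_open _ _ _ _ Hphi). exact HD.
Qed.

Lemma moving_curve_smooth : smooth_on moving_domain (fun z => phi (fst z) (g0 (snd z))).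
Proof.
  intros n.
  apply (Ck_comp (Ck_evaluable_prod _ _ Ck_evaluable_R Ck_evaluable_plane) n moving_domain
            (fun z => D (fst z) (snd z)) (fun z => (fst z, g0 (snd z)))
            (fun z => phi (fst z) (snd z))).
  - exact moving_domain_open.
  - intros z Hz. apply Hz.
  - apply Ck_pair.
    + apply (Ck_linear n _ (fun z => z) fst is_linear_fst), Ck_id.
    + apply (Ck_comp Ck_evaluable_R n _ (in_itv a b) snd g0).
      * exact moving_domain_open.
      * intros z Hz. apply Hz.
      * apply (Ck_linear n _ (fun z => z) snd is_linear_snd), Ck_id.
      * apply Hg.
  - apply (flow_smooth _ _ _ _ Hphi).
Qed.

Lemma moving_domain_slice_time t s : moving_domain (t, s) ->
  locally t (fun t' => moving_domain (t', s)).
Proof.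
  intros H. apply (locally_2d_1d_const_y (fun a b => moving_domain (a, b))).
  apply locally_2d_locally. apply (filter_imp moving_domain); [now intros []|].
  now apply moving_domain_open.
Qed.

Lemma moving_domain_slice t s : moving_domain (t, s) ->
  locally s (fun s' => moving_domain (t, s')).
Proof.
  intros H. apply (locally_2d_1d_const_x (fun a b => moving_domain (a, b))).
  apply locally_2d_locally. apply (filter_imp moving_domain); [now intros []|].
  now apply moving_domain_open.
Qed.

Lemma moving_domain_path t s tau : moving_domain (t, s) ->
  Rmin 0 t <= tau <= Rmax 0 t -> moving_domain (tau, s).
Proof.
  intros [Hs HD] Ht. simpl in *. split; [exact Hs|]. simpl.
  pose proof (proj1 (flow_zero _ _ _ _ Hphi (g0 s) (HgO s Hs))) as H0.
  destruct (Rle_dec 0 t).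
  - rewrite Rmin_left, Rmax_right in Ht by lra.
    now apply (flow_itv _ _ _ _ Hphi (g0 s) 0 tau t).
  - rewrite Rmin_right, Rmax_left in Ht by lra.
    now apply (flow_itv _ _ _ _ Hphi (g0 s) t tau 0).
Qed.

Definition moving_velocity (t s : R) : R * R := velocity (fun s' => phi t (g0 s')) s.

Lemma moving_curve_velocity t s : moving_domain (t, s) ->
  is_derive (fun s' => phi t (g0 s')) s (moving_velocity t s).
Proof.
  intros H. destruct (moving_curve_smooth 1%nat) as [L [HL _]].
  pose proof (is_derive_partial2 (fun z => phi (fst z) (g0 (snd z))) (L (t, s)) t s (HL _ H)) as Hd.
  simpl in Hd. unfold moving_velocity. now rewrite (is_derive_velocity _ _ _ Hd).
Qed.

Lemma moving_curve_in t s : moving_domain (t, s) -> O (phi t (g0 s)).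
Proof. intros H. apply (flow_ode _ _ _ _ Hphi), H. Qed.

Lemma moving_curve_time t s : moving_domain (t, s) ->
  is_derive (fun t' => phi t' (g0 s)) t (W (phi t (g0 s))).
Proof. intros H. apply (flow_ode _ _ _ _ Hphi), H. Qed.

(** If h grows along the flow at rate hW = dh(W), then the pairing dh(V) with the
velocity V of the moving curve satisfies d/dt dh(V) = d(hW)(V).  This is the
symmetry of the mixed derivatives of h(phi t (g0 s)). *)
Lemma differential_along_flow (h hW : R * R -> R) (lh lW : R * R -> R * R -> R) :
  Ck 2 O h -> (forall x, O x -> filterdiff h (locally x) (lh x)) ->
  (forall x, O x -> lh x (W x) = hW x) ->
  (forall x, O x -> filterdiff hW (locally x) (lW x)) ->
  forall t s, moving_domain (t, s) ->
  is_derive (fun t' => lh (phi t' (g0 s)) (moving_velocity t' s)) t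
            (lW (phi t (g0 s)) (moving_velocity t s)).
Proof.
  intros Ch Hh HhW HW t s H.
  apply (is_derive_ext_loc (fun t' => Derive (fun s' => h (phi t' (g0 s'))) s)).
  - apply (filter_imp (fun t' => moving_domain (t', s))); [|now apply moving_domain_slice_time].
    intros t' H'. apply is_derive_unique.
    apply (filterdiff_is_derive h (fun s' => phi t' (g0 s'))); [|now apply moving_curve_velocity].
    now apply Hh, moving_curve_in.
  - apply (Ck2_mixed moving_domain (fun z => h (phi (fst z) (g0 (snd z))))
             moving_domain_open) with (t := t) (s := s); [|exact H|].
    + apply (Ck_comp Ck_evaluable_plane 2 moving_domain O (fun z => phi (fst z) (g0 (snd z))) h).
      * exact moving_domain_open.
      * intros [t' s'] H'. now apply moving_curve_in.
      * apply moving_curve_smooth.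
      * exact Ch.
    + simpl. apply (is_derive_ext_loc (fun s' => hW (phi t (g0 s')))).
      * apply (filter_imp (fun s' => moving_domain (t, s'))); [|now apply moving_domain_slice].
        intros s' H'. symmetry. apply is_derive_unique.
        rewrite <- HhW by now apply moving_curve_in.
        apply (filterdiff_is_derive h (fun t' => phi t' (g0 s'))); [|now apply moving_curve_time].
        now apply Hh, moving_curve_in.
      * apply (filterdiff_is_derive hW (fun s' => phi t (g0 s'))); [|now apply moving_curve_velocity].
        now apply HW, moving_curve_in.
Qed.

Lemma moving_velocity_zero s : in_itv a b s -> moving_velocity 0 s = velocity g0 s.
Proof.
  intros Hs. apply velocity_ext_loc.
  apply (filter_imp (in_itv a b)); [|now apply open_in_itv].
  intros u Hu. apply (flow_zero _ _ _ _ Hphi), HgO, Hu.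
Qed.

Lemma continuous_along_flow (f : R * R -> R) t s :
  Ck 0 O f -> moving_domain (t, s) -> continuous (fun t' => f (phi t' (g0 s))) t.
Proof.
  intros Hf H. apply (continuous_comp (fun t' => phi t' (g0 s)) f).
  - apply (is_derive_continuous _ _ _ (moving_curve_time t s H)).
  - exact (Hf _ (moving_curve_in t s H)).
Qed.

(** When d(dh(W)) = lam dh, the function w = dh(V) solves w' = lam w, so it
vanishes if it does at time 0; Gronwall is applied to w^2. *)
Lemma tangency_preserved (h : R * R -> R) (lh : R * R -> R * R -> R) (lam : R * R -> R) :
  Ck 2 O h -> (forall x, O x -> filterdiff h (locally x) (lh x)) -> Ck 0 O lam ->
  (forall x, O x -> filterdiff (fun y => lh y (W y)) (locally x) (fun v => lam x * lh x v)) ->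
  forall t s, moving_domain (t, s) ->
  lh (g0 s) (velocity g0 s) = 0 -> lh (phi t (g0 s)) (moving_velocity t s) = 0.
Proof.
  intros Ch Hh Cl Hl t s H H0.
  pose proof (differential_along_flow h _ lh _ Ch Hh (fun x _ => eq_refl) Hl) as HD.
  set (w := fun tau => lh (phi tau (g0 s)) (moving_velocity tau s)).
  destruct (path_bounded (fun tau => lam (phi tau (g0 s))) 0 t) as [M [M0 HM]].
  { intros tau Htau. apply continuous_along_flow; [exact Cl|]. now apply (moving_domain_path t). }
  assert (E : w t * w t = 0).
  { apply (gronwall_zero (fun tau => w tau * w tau)
             (fun tau => 2 * lam (phi tau (g0 s)) * (w tau * w tau)) (2 * M) 0 t).
    - intros tau Htau. pose proof (moving_domain_path t s tau H Htau) as Hd.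
      pose proof (HD tau s Hd) as Hw. fold w in Hw.
      split; [|split].
      + evar_last; [exact (is_derive_mult w w tau _ _ Hw Hw Rmult_comm)|].
        unfold plus, mult, w; simpl. ring.
      + nra.
      + rewrite !Rabs_mult, (Rabs_right 2) by lra.
        specialize (HM tau Htau). pose proof (Rabs_pos (w tau)).
        replace (w tau * w tau) with (Rabs (w tau) * Rabs (w tau)).
        * nra.
        * rewrite <- Rabs_mult. apply Rabs_right. nra.
    - destruct H as [Hs _]. simpl in Hs. unfold w.
      rewrite (proj2 (flow_zero _ _ _ _ Hphi (g0 s) (HgO s Hs))), moving_velocity_zero by exact Hs.
      rewrite H0. ring. }
  apply Rmult_integral in E. now destruct E.
Qed.

(** The linearized flow equation V' = DW(V), read off from
[differential_along_flow] with h a coordinate function. *)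
Lemma moving_velocity_derive (L : R * R -> R * R -> R * R) :
  (forall x, O x -> filterdiff W (locally x) (L x)) ->
  forall t s, moving_domain (t, s) ->
  is_derive (fun t' => moving_velocity t' s) t (L (phi t (g0 s)) (moving_velocity t s)).
Proof.
  intros HL t s H.
  pose proof (differential_along_flow fst (fun x => fst (W x)) (fun _ => fst) (fun x w => fst (L x w))
     (Ck_linear 2 O (fun x => x) fst is_linear_fst (Ck_id 2 O))
     (fun x _ => filterdiff_linear fst is_linear_fst) (fun x _ => eq_refl)
     (fun x Hx => filterdiff_comp' W fst x (L x) fst (HL x Hx) (filterdiff_linear fst is_linear_fst))
     t s H) as H1.
  pose proof (differential_along_flow snd (fun x => snd (W x)) (fun _ => snd) (fun x w => snd (L x w))
     (Ck_linear 2 O (fun x => x) snd is_linear_snd (Ck_id 2 O))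
     (fun x _ => filterdiff_linear snd is_linear_snd) (fun x _ => eq_refl)
     (fun x Hx => filterdiff_comp' W snd x (L x) snd (HL x Hx) (filterdiff_linear snd is_linear_snd))
     t s H) as H2.
  pose proof (is_derive_pair _ _ t _ _ H1 H2) as H3.
  rewrite <- surjective_pairing in H3. exact H3.
Qed.

Lemma moving_velocity_continuous t s : moving_domain (t, s) ->
  continuous (fun t' => moving_velocity t' s) t.
Proof.
  intros H. destruct (flow_field_Ck O W D phi 1 HO Hphi) as [L [HL _]].
  apply (is_derive_continuous _ _ _ (moving_velocity_derive L HL t s H)).
Qed.

(** V solves a linear equation, so if it vanished at time t, Gronwall applied to
|V|^2 from t back to 0 would make it vanish at time 0. *)
Lemma immersion_preserved t s : moving_domain (t, s) ->
  velocity g0 s <> (0, 0) -> moving_velocity t s <> (0, 0).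
Proof.
  intros H H0 Hz.
  destruct (flow_field_Ck O W D phi 1 HO Hphi) as [L [HL CL]].
  set (v := fun tau => moving_velocity tau s).
  set (A := fun tau => L (phi tau (g0 s))).
  assert (Hv : forall tau, Rmin t 0 <= tau <= Rmax t 0 -> is_derive v tau (A tau (v tau))).
  { intros tau Htau. rewrite Rmin_comm, Rmax_comm in Htau.
    apply (moving_velocity_derive L HL). now apply (moving_domain_path t). }
  (* The columns of DW are bounded along the compact path from time t to 0. *)
  assert (HB : forall e : R * R, exists M, 0 <= M /\
     forall tau, Rmin t 0 <= tau <= Rmax t 0 ->
       Rabs (fst (A tau e)) <= M /\ Rabs (snd (A tau e)) <= M).
  { intros e.
    destruct (path_bounded (fun tau => fst (A tau e)) t 0) as [M1 [P1 B1]].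
    { intros tau Htau. rewrite Rmin_comm, Rmax_comm in Htau.
      apply (continuous_along_flow (fun x => fst (L x e)));
        [|now apply (moving_domain_path t)].
      apply (Ck_linear 0 O (fun x => L x e) fst is_linear_fst (CL e)). }
    destruct (path_bounded (fun tau => snd (A tau e)) t 0) as [M2 [P2 B2]].
    { intros tau Htau. rewrite Rmin_comm, Rmax_comm in Htau.
      apply (continuous_along_flow (fun x => snd (L x e)));
        [|now apply (moving_domain_path t)].
      apply (Ck_linear 0 O (fun x => L x e) snd is_linear_snd (CL e)). }
    exists (M1 + M2). split; [lra|]. intros tau Htau.
    specialize (B1 tau Htau). specialize (B2 tau Htau). lra. }
  destruct (HB (1, 0)) as [M1 [P1 B1]]. destruct (HB (0, 1)) as [M2 [P2 B2]].
  assert (E : dot (v 0) (v 0) = 0).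
  { apply (gronwall_zero (fun tau => dot (v tau) (v tau))
             (fun tau => dot (A tau (v tau)) (v tau) + dot (v tau) (A tau (v tau)))
             (4 * (M1 + M2)) t 0).
    - intros tau Htau. split; [|split].
      + apply is_derive_dot; now apply Hv.
      + unfold dot; nra.
      + pose proof (moving_domain_path t s tau H) as Hd.
        rewrite Rmin_comm, Rmax_comm in Hd. specialize (Hd Htau).
        pose proof (proj1 (HL _ (moving_curve_in _ _ Hd))) as Lin.
        now apply (linear_dot_bound (A tau)); [|apply B1|apply B1|apply B2|apply B2].
    - change (dot (moving_velocity t s) (moving_velocity t s) = 0). rewrite Hz. unfold dot; simpl; ring. }
  unfold v in E. rewrite moving_velocity_zero in E by apply H.
  apply dot_pos in H0. lra.
Qed.

End MovingCurve.

(** * The inverse curvature flow *)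

Lemma in_level_set_of_tangent (U : R * R -> R) a b (g : R -> R * R) :
  smooth_on (fun _ => True) U ->
  (forall s, in_itv a b s -> exists v, is_derive g s v /\ dot (grad U (g s)) v = 0) ->
  in_level_set U a b g.
Proof.
  intros HU H.
  destruct (classic (exists s, in_itv a b s)) as [[s0 H0]|N].
  - exists (U (g s0)). intros s Hs.
    apply (is_derive_zero_const a b (fun s => U (g s))); auto.
    intros u Hu. destruct (H u Hu) as [v [Hd <-]].
    exact (filterdiff_is_derive U g u _ v (grad_gradient U HU (g u)) Hd).
  - exists 0. intros s Hs. elim N. now exists s.
Qed.

Lemma flow_tangent_to_levels (U K : R * R -> R) D phi a b g0 :
  levi_potential U -> level_curvature U K -> is_flow (reg U) (icf_field U K) D phi ->
  smooth_on (in_itv a b) g0 -> (forall s, in_itv a b s -> reg U (g0 s)) ->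
  in_level_set U a b g0 ->
  forall t s, moving_domain D a b g0 (t, s) ->
  dot (grad U (phi t (g0 s))) (moving_velocity phi g0 t s) = 0.
Proof.
  intros HL HK Hphi Hg Hreg Hlev t s H. pose proof (proj1 HL) as HU.
  pose proof (reg_open U HU) as HO.
  assert (HgC : forall n, Ck n (reg U) (grad U)).
  { intros n. apply (Ck_subset n (fun _ => True)); [easy|now apply grad_Ck]. }
  assert (CF : Ck 1 (reg U) (fun p => dot (grad U p) (icf_field U K p))).
  { apply Ck_dot; [apply HgC|now apply (flow_field_Ck _ _ D phi)]. }
  destruct CF as [L [HLd HLc]].
  apply (tangency_preserved (reg U) (icf_field U K) D phi a b g0 Hphi Hg Hreg U (fun x => dot (grad U x))
    (fun x => dot (grad U x) (L x (1, 0), L x (0, 1)) / dot (grad U x) (grad U x))).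
  - apply (Ck_subset 2 (fun _ => True)); [easy|apply HU].
  - intros x _. now apply grad_gradient.
  - intros x Hx.
    apply (continuous_mult (fun x => dot (grad U x) (L x (1, 0), L x (0, 1)))
                           (fun x => / dot (grad U x) (grad U x))).
    + apply (Ck_dot 0 (reg U) (grad U) (fun x => (L x (1, 0), L x (0, 1)))); [apply HgC| |exact Hx].
      apply Ck_pair; apply HLc.
    + apply (continuous_comp (fun x => dot (grad U x) (grad U x)) Rinv).
      * apply continuous_dot; now apply grad_continuous.
      * apply continuous_Rinv. apply dot_pos in Hx. lra.
  - intros x Hx. apply (filterdiff_ext_lin _ (L x)); [now apply HLd|].
    intros v. apply (rate_differential_parallel U K x (L x) HL HK Hx). now apply HLd.
  - exact H.
  - destruct H as [Hs _]. simpl in Hs. apply (level_curve_tangent U a b g0 s _ HU Hlev Hs).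
    destruct (Hg 1%nat) as [M [HM _]]. pose proof (HM s Hs) as Hd.
    assert (Hd' : is_derive g0 s (M s 1)).
    { apply (filterdiff_ext_lin _ _ _ Hd). intros y.
      rewrite <- (linear_scal _ (proj1 Hd)). f_equal. symmetry. apply Rmult_1_r. }
    now rewrite (is_derive_velocity _ _ _ Hd').
Qed.

Theorem proposition3p3
  (U K : R * R -> R)
  (D : R -> R * R -> Prop) (phi : R -> R * R -> R * R)
  (a b : Rbar) (g0 : R -> R * R)
  (HU : levi_potential U)
  (HK : level_curvature U K)
  (Hphi : is_flow (reg U) (fun x => scal (/ K x) (unit_grad U x)) D phi)
  (Hab : Rbar_lt a b)
  (Himm : immersed_curve a b g0)
  (Hreg : forall s, in_itv a b s -> reg U (g0 s))
  (Hlev : in_level_set U a b g0) :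
  (forall t, (forall s, in_itv a b s -> D t (g0 s)) ->
     in_level_set U a b (fun s => phi t (g0 s))) /\
  (direct U a b g0 ->
     icf_solution (fun t s => in_itv a b s /\ D t (g0 s))
                  (fun t s => phi t (g0 s))).
Proof.
  pose proof (proj1 HU) as HUs. destruct Himm as [Hg Hv0].
  pose proof (reg_open U HUs) as HO.
  pose proof (flow_tangent_to_levels U K D phi a b g0 HU HK Hphi Hg Hreg Hlev) as Htan.
  pose proof (moving_curve_velocity (reg U) _ D phi a b g0 Hphi Hg) as Hvel.
  pose proof (moving_curve_in (reg U) _ D phi a b g0 Hphi) as Hin.
  split.
  - intros t HD. apply in_level_set_of_tangent; [exact HUs|].
    intros s Hs. exists (moving_velocity phi g0 t s).
    split; [apply Hvel|apply Htan]; (split; [exact Hs|now apply HD]).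
  - intros Hdir.
    pose proof (moving_domain_open (reg U) _ D phi a b g0 Hphi Hg) as Hopen.
    pose proof (moving_curve_smooth (reg U) _ D phi a b g0 Hphi Hg) as Hsm.
    assert (Himm : forall t s, moving_domain D a b g0 (t, s) -> moving_velocity phi g0 t s <> (0, 0)).
    { intros t s H. apply (immersion_preserved (reg U) _ D phi a b g0 HO Hphi Hg Hreg t s H).
      apply Hv0, H. }
    assert (Hpos : forall t s, moving_domain D a b g0 (t, s) ->
       0 < dot (moving_velocity phi g0 t s) (J (grad U (phi t (g0 s))))).
    { intros t s H.
      apply (path_pos (fun tau => dot (moving_velocity phi g0 tau s) (J (grad U (phi tau (g0 s))))) 0 t).
      - intros tau Htau.
        pose proof (moving_domain_path (reg U) _ D phi a b g0 Hphi Hreg t s tau H Htau) as Hd.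
        split.
        + apply continuous_dot_J.
          * now apply (moving_velocity_continuous (reg U) _ D phi a b g0 HO Hphi Hg).
          * apply (continuous_comp (fun tau => phi tau (g0 s)) (grad U)).
            -- apply (is_derive_continuous _ _ _ (moving_curve_time (reg U) _ D phi a b g0 Hphi tau s Hd)).
            -- now apply grad_continuous.
        + apply dot_J_neq0; [now apply Himm|now apply Hin|].
          rewrite dot_comm. exact (Htan tau s Hd).
      - destruct H as [Hs _]. simpl in Hs.
        rewrite (proj2 (flow_zero _ _ _ _ Hphi (g0 s) (Hreg s Hs))).
        rewrite (moving_velocity_zero (reg U) _ D phi a b g0 Hphi Hreg s Hs).
        apply dot_J_unit_grad; [now apply Hreg|now apply Hdir]. }
    split; [exact Hopen|split; [exact Hsm|]].
    intros t s [Hs HD].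
    assert (H : moving_domain D a b g0 (t, s)) by (split; assumption).
    assert (HN : unit_normal (fun s => phi t (g0 s)) s = unit_grad U (phi t (g0 s))).
    { apply normal_is_unit_grad; [|now apply Hpos].
      rewrite dot_comm. exact (Htan t s H). }
    (* K is evaluated on gamma_t restricted to a short interval around s, since
       phi t (g0 s') need not be defined for all s'. *)
    assert (HKc : K (phi t (g0 s)) = curvature (fun s => phi t (g0 s)) s).
    { destruct (moving_domain_slice (reg U) _ D phi a b g0 Hphi Hg t s H) as [d Hd].
      assert (Hsub : forall u, in_itv (s - d)%R (s + d)%R u -> moving_domain D a b g0 (t, u)).
      { intros u [H1 H2]. simpl in H1, H2. apply Hd.
        change (Rabs (u - s) < d). apply Rabs_def1; lra. }
      apply (HK (s - d)%R (s + d)%R (fun s => phi t (g0 s))).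
      - split.
        + intros n.
          apply (Ck_comp Ck_evaluable_plane n _ (moving_domain D a b g0) (fun u => (t, u))
                   (fun z => phi (fst z) (g0 (snd z)))).
          * apply open_in_itv.
          * exact Hsub.
          * apply Ck_pair; [apply Ck_const|apply Ck_id].
          * apply Hsm.
        + intros u Hu. now apply Himm, Hsub.
      - intros u Hu. now apply Hin, Hsub.
      - apply in_level_set_of_tangent; [exact HUs|]. intros u Hu.
        exists (moving_velocity phi g0 t u). split; [apply Hvel|apply Htan]; now apply Hsub.
      - intros u Hu. apply dot_J_unit_grad; [now apply Hin, Hsub|now apply Hpos, Hsub].
      - split; simpl; destruct d; simpl; lra. }
    split; [now apply Himm|split].
    + rewrite <- HKc. apply Rgt_not_eq, (curvature_pos U K); auto.
    + rewrite <- HKc, HN. now apply (flow_ode _ _ _ _ Hphi).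
Qed.
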